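(* Let $S$ be a semigroup with zero such that $Z(S)\neq S$, and suppose that for all $a,b,c\in S$, $abc=0$ implies $ab=0$, $bc=0$, or $ac=0$. Then $\overrightarrow{\Gamma}(S)=\overrightarrow{\Gamma}_{E}(S)=\overrightarrow{\mathrm{AG}}(S)$.
   Context: Let $S$ be a semigroup with zero, not necessarily commutative; for $A\subseteq S$, $A^{*}=A\setminus\{0\}$. An element $x\in S$ is a left (resp. right) zero divisor if $xy=0$ (resp. $yx=0$) for some $y\in S^{*}$; $Z(S)$ is the set of all elements that are left or right zero divisors. For $x\in S$, $\mathrm{Ann}_{l}(x)=\{s\in S: sx=0\}$ and $\mathrm{Ann}_{r}(x)=\{s\in S: xs=0\}$. The following are simple digraphs (no loops, no multiple arcs), all with vertex set $Z(S)^{*}$; for distinct $x,y\in Z(S)^{*}$: (1) in the zero-divisor digraph $\overrightarrow{\Gamma}(S)$, $x\to y$ is an arc iff $xy=0$; (2) in the extended zero-divisor digraph $\overrightarrow{\Gamma}_{E}(S)$, $x\to y$ is an arc iff $x^{n}y^{m}=0$ for some positive integers $n,m$ with $x^{n}\neq 0$ and $y^{m}\neq 0$; (3) in the annihilator digraph $\overrightarrow{\mathrm{AG}}(S)$, $x\to y$ is an arc iff $\mathrm{Ann}_{l}(xy)\setminus(\mathrm{Ann}_{l}(x)\cup\mathrm{Ann}_{l}(y))\neq\emptyset$ or $\mathrm{Ann}_{r}(xy)\setminus(\mathrm{Ann}_{r}(x)\cup\mathrm{Ann}_{r}(y))\neq\emptyset$. Equality of these digraphs means equality of arc sets. *)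

(* Defs.v *)
From HB Require Import structures.
From mathcomp Require Import all_boot.
From mathcomp Require Import boolp classical_sets.

Set Implicit Arguments.
Unset Strict Implicit.
Unset Printing Implicit Defensive.

Local Open Scope classical_set_scope.
Local Open Scope group_scope.

HB.mixin Record Semigroup_hasZero S of Semigroup S := {
  szero : S;
  smul0s : left_zero szero (@mul S);
  smuls0 : right_zero szero (@mul S)
}.

#[short(type="semigroup0Type")]
HB.structure Definition Semigroup0 :=
  {S of Semigroup_hasZero S & Semigroup S}.

Bind Scope group_scope with Semigroup0.sort.

Notation "0" := (@szero _) : group_scope.

(* There is no unit in general: only the values for n > 0, where x appears
   n times as a factor, are meaningful; spow x 0 = x is a dummy value. *)
Definition spow (S : semigroupType) (x : S) (n : nat) : S := iterop n mul x x.

Section ZeroDivisors.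
Variable S : semigroup0Type.
Implicit Types (A : set S) (x y s : S).

Definition nonzero A : set S := A `\` [set 0].

Definition left_zero_divisor x := exists2 y, nonzero [set: S] y & x * y = 0.

Definition right_zero_divisor x := exists2 y, nonzero [set: S] y & y * x = 0.

Definition zero_divisors : set S :=
  [set x | left_zero_divisor x \/ right_zero_divisor x].

Definition annl x : set S := [set s | s * x = 0].

Definition annr x : set S := [set s | x * s = 0].

End ZeroDivisors.

Arguments zero_divisors S : clear implicits.

Record simple_digraph (T : Type) := SimpleDigraph {
  vertices : set T;
  arcs : set (T * T);
  arcs_vertices : arcs `<=` vertices `*` vertices;
  arcs_loopless : forall x, ~ arcs (x, x)
}.

Section DigraphOn.
Variables (T : Type) (V : set T) (r : T -> T -> Prop).

Definition arcs_on : set (T * T) :=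
  [set a | [/\ V a.1, V a.2, a.1 <> a.2 & r a.1 a.2]].

Lemma arcs_on_vertices : arcs_on `<=` V `*` V.
Proof. by move=> a []. Qed.

Lemma arcs_on_loopless x : ~ arcs_on (x, x).
Proof. by case. Qed.

Definition digraph_on : simple_digraph T :=
  SimpleDigraph arcs_on_vertices arcs_on_loopless.

End DigraphOn.

Section Digraphs.
Variable S : semigroup0Type.

Definition zero_divisor_digraph : simple_digraph S :=
  digraph_on (nonzero (zero_divisors S)) (fun x y => x * y = 0).

Definition extended_zero_divisor_digraph : simple_digraph S :=
  digraph_on (nonzero (zero_divisors S)) (fun x y =>
    exists n m : nat, [/\ (0 < n)%N, (0 < m)%N,
      spow x n * spow y m = 0, spow x n <> 0 & spow y m <> 0]).

Definition annihilator_digraph : simple_digraph S :=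
  digraph_on (nonzero (zero_divisors S)) (fun x y =>
    annl (x * y) `\` (annl x `|` annl y) !=set0 \/
    annr (x * y) `\` (annr x `|` annr y) !=set0).

End Digraphs.

Arguments zero_divisor_digraph S : clear implicits.
Arguments extended_zero_divisor_digraph S : clear implicits.
Arguments annihilator_digraph S : clear implicits.

(* Main.v *)
Require Import Defs.
From mathcomp Require Import all_boot.
From mathcomp Require Import boolp classical_sets.

Local Open Scope classical_set_scope.
Local Open Scope group_scope.

(** Each of the two larger digraphs is compared with the zero-divisor digraph.

    The hypothesis on triple products does both upper bounds. An arc [x -> y]
    of the annihilator digraph comes with an [s] such that [s * x * y = 0] while
    [s * x] and [s * y] are nonzero (or the mirror image), so the only pair of
    factors left to annihilate is [x * y]. For the extended digraph, [x * y = 0]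
    is obtained from [x ^ n * y ^ m = 0] by stripping off factors one at a time:
    once a nonzero power is written as [x * x ^ n], that pair cannot vanish, so
    one of the two other pairs does, and it gives the claim or shortens the power
    ([mul_spow_eq0l], [mul_spow_eq0r]).

    Conversely, [x * y = 0] is an arc of the extended digraph with exponents 1.
    It is an arc of the annihilator digraph because [zero_divisors S] is not the
    whole of [S]: an element that is not a left zero divisor annihilates
    [0 = x * y] from the left, but neither of the nonzero elements [x] and [y]. *)

Definition null_triples_have_null_pair (S : semigroup0Type) := forall a b c : S,
  a * b * c = 0 -> a * b = 0 \/ b * c = 0 \/ a * c = 0.

(** The factor [y] is arbitrary, so that it can be instantiated with a power;
    the induction goes on because [x ^ n] is nonzero when [x * x ^ n] is. *)
Lemma mul_spow_eq0l (S : semigroup0Type) (triple_eq0 : null_triples_have_null_pair S)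
    (x y : S) (n : nat) :
  (0 < n)%N -> spow x n <> 0 -> spow x n * y = 0 -> x * y = 0.
Proof.
case: n => // n _; elim: n => [//|n IHn].
have -> : spow x n.+2 = x * spow x n.+1 by [].
move=> xxn0 /triple_eq0 [//|[xny0|//]].
by apply: IHn => // xn0; apply: xxn0; rewrite xn0 smuls0.
Qed.

(** Peeling [y] off the left of [y * y ^ m] puts it next to [x], so the pairs
    left over are [x * y], which is the claim, and the shorter [x * y ^ m]. *)
Lemma mul_spow_eq0r (S : semigroup0Type) (triple_eq0 : null_triples_have_null_pair S)
    (x y : S) (m : nat) :
  (0 < m)%N -> spow y m <> 0 -> x * spow y m = 0 -> x * y = 0.
Proof.
case: m => // m _; elim: m => [//|m IHm].
have -> : spow y m.+2 = y * spow y m.+1 by [].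
move=> yym0; rewrite mulgA => /triple_eq0 [//|[//|xym0]].
by apply: IHm => // ym0; apply: yym0; rewrite ym0 smuls0.
Qed.

(** The witness [s] of the arc forms with [x] and [y] a null triple in which
    both pairs containing [s] are nonzero. *)
Lemma annihilator_arc_mul_eq0 (S : semigroup0Type)
    (triple_eq0 : null_triples_have_null_pair S) (x y : S) :
  annl (x * y) `\` (annl x `|` annl y) !=set0 \/
  annr (x * y) `\` (annr x `|` annr y) !=set0 -> x * y = 0.
Proof.
case=> -[s []]; rewrite /annl /annr /=.
  by rewrite mulgA => /triple_eq0 sxy0 /not_orP [? ?]; case: sxy0 => [|[]].
by move=> /triple_eq0 xys0 /not_orP [? ?]; case: xys0 => [|[]].
Qed.

Lemma exists_not_left_zero_divisor (S : semigroup0Type) :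
  zero_divisors S <> [set: S] -> exists u : S, ~ left_zero_divisor u.
Proof.
move=> ZneqS; apply/existsNP => ZS; apply: ZneqS.
by apply/seteqP; split=> // x _; left; apply: ZS.
Qed.

Lemma eq_arcs_on (T : Type) (V : set T) (r r' : T -> T -> Prop) :
  (forall x y, V x -> V y -> r x y <-> r' x y) -> arcs_on V r = arcs_on V r'.
Proof.
move=> rr'; apply/seteqP; split=> -[x y] [/= Vx Vy xy rxy];
  by split=> //=; apply/(rr' x y Vx Vy).
Qed.

Theorem corollary4p12 (S : semigroup0Type)
  (hZ : zero_divisors S <> [set: S])
  (h3 : forall a b c : S,
    a * b * c = 0 -> a * b = 0 \/ b * c = 0 \/ a * c = 0) :
  arcs (zero_divisor_digraph S) = arcs (extended_zero_divisor_digraph S) /\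
  arcs (extended_zero_divisor_digraph S) = arcs (annihilator_digraph S).
Proof.
have GE : arcs (zero_divisor_digraph S) = arcs (extended_zero_divisor_digraph S).
  apply: eq_arcs_on => x y [_ x0] [_ y0]; split=> [xy0|]; first by exists 1%N, 1%N.
  move=> [n [m [n_gt0 m_gt0 xnym0 xn0 ym0]]].
  apply: (mul_spow_eq0r S h3 x y m m_gt0 ym0).
  exact: (mul_spow_eq0l S h3 x (spow y m) n n_gt0 xn0).
split=> //; rewrite -GE; have [u uNZ] := exists_not_left_zero_divisor S hZ.
apply: eq_arcs_on => x y [_ x0] [_ y0].
split; last exact: (annihilator_arc_mul_eq0 S h3).
move=> xy0; left; exists u; split; first by rewrite /annl /= xy0 smuls0.
by case=> [ux0|uy0]; apply: uNZ; [exists x | exists y].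
Qed.
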